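(* Let $\mathcal D_1$, $\mathcal D_2$, and $\mathcal D$ be three homothetic ellipses with common center. Suppose that $P_1$ is a pentagon of density $1$ inscribed in $\mathcal D_1$ and circumscribed about $\mathcal D$, and that $P_2$ is a pentagon of density $2$ inscribed in $\mathcal D_2$ and circumscribed about $\mathcal D$. Then the sum of the areas of the five power circles of $P_1$ equals the sum of the areas of the five power circles of $P_2$.
   Context: All objects lie in the Euclidean plane. A pentagon $A_0A_1A_2A_3A_4$ is a cyclically ordered sequence of $5$ distinct points (vertices), with sides $\overline{A_kA_{k+1}}$ (indices modulo $5$); it may be self-crossing. It is inscribed in an ellipse if all its vertices lie on the ellipse, and circumscribed about an ellipse if every line $A_kA_{k+1}$ is tangent to the ellipse. Ellipses with common center $O$ are homothetic if each is the image of any other under a homothety centered at $O$; circles are allowed as ellipses. Density: a pentagon inscribed in an ellipse has density $q\in\{1,2\}$ if its vertices are connected in the same cyclic ordering as the regular polygon $\{5/q\}$ (whose vertices are obtained by successive rotations through $2q\pi/5$): that is, if $V_0,\dots,V_4$ are its vertices listed in cyclic order around the ellipse in which it is inscribed (in a suitable one of the two directions, starting at $V_0=A_0$), then $A_k=V_{qk \bmod 5}$ for all $k$. So density $1$ means convex, density $2$ means a pentagram-type star. Power circles: let $M_k$ be the midpoint of $\overline{A_{k+2}A_{k+3}}$ (indices modulo $5$). The power circle corresponding to the vertex $A_k$ is the circle centered at $M_k$ passing through $A_k$. The area of a circle means the area of the disk it bounds. *)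

(* Defs.v *)
From HB Require Import structures.
From mathcomp Require Import all_boot all_order all_algebra.
From mathcomp Require Import all_classical all_reals all_analysis.
Set Implicit Arguments.
Unset Strict Implicit.
Unset Printing Implicit Defensive.
Import Order.TTheory GRing.Theory Num.Theory.
Import numFieldNormedType.Exports.
Local Open Scope classical_set_scope.
Local Open Scope ring_scope.

Section PlaneGeometry.
Context {R : realType}.

Local Notation plane := (R * R)%type.

(* The library norm on a product is the sup norm, hence this distance. *)
Definition edist (p q : plane) : R :=
  Num.sqrt ((p.1 - q.1) ^+ 2 + (p.2 - q.2) ^+ 2).

Definition midpoint (p q : plane) : plane :=
  ((p.1 + q.1) / 2, (p.2 + q.2) / 2).

Definition line (p q : plane) : set plane :=
  [set (p.1 + t * (q.1 - p.1), p.2 + t * (q.2 - p.2)) | t in [set: R]].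

(* The unit vector u is the direction of the axis with semi-axis a; the other
   axis is directed by (- u.2, u.1).  The case a = b is a circle. *)
Definition is_ellipse (O : plane) (E : set plane) : Prop :=
  exists (a b : R) (u : plane),
    [/\ 0 < a, 0 < b, u.1 ^+ 2 + u.2 ^+ 2 = 1 &
      E = [set p : plane |
        (((p.1 - O.1) * u.1 + (p.2 - O.2) * u.2) / a) ^+ 2 +
        (((p.2 - O.2) * u.1 - (p.1 - O.1) * u.2) / b) ^+ 2 = 1]].

Definition homothety (O : plane) (k : R) (p : plane) : plane :=
  (O.1 + k * (p.1 - O.1), O.2 + k * (p.2 - O.2)).

Definition homothetic (O : plane) (Es : set (set plane)) : Prop :=
  forall E F, Es E -> Es F ->
    exists2 k : R, k != 0 & F = homothety O k @` E.

(* For an ellipse, a line is tangent iff it has a single common point. *)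
Definition tangent (l E : set plane) : Prop :=
  exists p : plane, l `&` E = [set p].

(* A pentagon is its family of vertices; index arithmetic is modulo 5. *)
Definition pentagon (A : 'Z_5 -> plane) : Prop := injective A.

Definition inscribed (A : 'Z_5 -> plane) (E : set plane) : Prop :=
  forall k, E (A k).

Definition circumscribed (A : 'Z_5 -> plane) (E : set plane) : Prop :=
  forall k, tangent (line (A k) (A (k + 1))) E.

(* V 0, ..., V 4 occur in this order during one counterclockwise turn
   around O: r i and t i are polar coordinates of V i about O. *)
Definition ccw_order (O : plane) (V : 'Z_5 -> plane) : Prop :=
  exists r t : 'Z_5 -> R,
    (forall i, 0 < r i /\
       V i = (O.1 + r i * cos (t i), O.2 + r i * sin (t i))) /\
    (forall i j : 'Z_5, (i < j)%N -> t i < t j < t i + 2 * pi).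

(* The second case is the clockwise direction. An ellipse meets every ray from
   its center O exactly once, so for points of an ellipse centered at O this is
   the cyclic order around the ellipse. *)
Definition cyclic_order (O : plane) (V : 'Z_5 -> plane) : Prop :=
  ccw_order O V \/ ccw_order O (fun i => V (- i)).

(* For a pentagon inscribed in an ellipse with center O. *)
Definition has_density (O : plane) (A : 'Z_5 -> plane) (q : nat) : Prop :=
  exists V : 'Z_5 -> plane,
    [/\ cyclic_order O V, V 0 = A 0 & forall k, A k = V (q%:R * k)].

Definition disk (c : plane) (r : R) : set plane := [set p | edist c p <= r].

Definition area (X : set plane) : \bar R :=
  ((@lebesgue_measure R) \x (@lebesgue_measure R))%E X.

Definition power_center (A : 'Z_5 -> plane) (k : 'Z_5) : plane :=
  midpoint (A (k + 2)) (A (k + 3)).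

Definition power_circle_area (A : 'Z_5 -> plane) (k : 'Z_5) : \bar R :=
  area (disk (power_center A k) (edist (power_center A k) (A k))).

End PlaneGeometry.

(* Main.v *)
Require Import Defs.
From mathcomp Require Import all_boot all_order all_algebra.
From mathcomp Require Import all_classical all_reals all_analysis.
From mathcomp Require Import ring lra.
Import Order.TTheory GRing.Theory Num.Theory.
Import numFieldNormedType.Exports.
Local Open Scope classical_set_scope.
Local Open Scope ring_scope.
Set Implicit Arguments.
Unset Strict Implicit.

(** The total area of the power circles depends only on the inner ellipse: if its
    semi-axes are [a] and [b], it is [25 pi (a^2 + b^2) / 2]
    ([sum_power_circle_area]), for the convex pentagon as well as for the star.

    An affine map takes the inner ellipse to the unit circle and the outer one to
    a concentric circle, of squared radius [rho].  A side is then a chord of the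
    outer circle whose midpoint is its point of contact ([tangent_midpoint]), so
    all sides have the same central angle, and the image of the pentagon is a
    regular polygon, convex or starred.  Algebraically, its vertices [v_k] satisfy
    [v_(k-1) + v_(k+1) = c v_k] with [rho (c + 2) = 4] ([chord_recurrence]), and
    periodicity leaves the two roots of [c^2 + c - 1 = 0] ([turn_golden]), that is
    [c = 2 cos (2 pi q / 5)] for the density [q].

    The vector from [v_k] to the midpoint of the opposite side is
    [(c^2 - 4) / 2] times [v_k], and the squares of each coordinate of the [v_k]
    add up to [5 rho / 2] ([sum_sqr_coordinate]).  The squares of each coordinate
    of these vectors therefore add up to an expression in [c] that equals
    [25 / 2] for both roots ([sum_sqr_median]).  Undoing the affine map scales the
    two coordinates by [a] and [b], and the area of a disk is [pi r^2]
    ([area_disk]). *)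

(** * Area of a disk *)

Lemma xsection_disk (R : realType) (c : R * R) (r x : R) : 0 <= r ->
  xsection (disk c r) x =
  if x \in `[c.1 - r, c.1 + r] then
    [set` `[c.2 - Num.sqrt (r ^+ 2 - (x - c.1) ^+ 2),
            c.2 + Num.sqrt (r ^+ 2 - (x - c.1) ^+ 2)]]
  else set0.
Proof.
move=> r0.
have diskE y : xsection (disk c r) x y <->
    (y - c.2) ^+ 2 <= r ^+ 2 - (x - c.1) ^+ 2.
  rewrite /xsection /disk /Defs.edist /= inE /=.
  have -> : (c.1 - x) ^+ 2 + (c.2 - y) ^+ 2
    = (x - c.1) ^+ 2 + (y - c.2) ^+ 2 by ring.
  by rewrite -[X in _ <= X]ger0_norm// -sqrtr_sqr ler_sqrt ?sqr_ge0// lerBrDl.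
have xrE : (x \in `[c.1 - r, c.1 + r]) = (0 <= r ^+ 2 - (x - c.1) ^+ 2).
  rewrite in_itv/= -ler_distl subr_ge0 -[in RHS]real_normK ?num_real//.
  by rewrite ler_sqr ?nnegrE.
case: ifPn => [|] xr; rewrite xrE in xr; apply/seteqP; split => y //=.
- by rewrite in_itv/= diskE -ler_distl -sqrtr_sqr ler_sqrt.
- by rewrite in_itv/= -ler_distl -sqrtr_sqr ler_sqrt// => /diskE.
- move=> /diskE yr; move: xr; rewrite -ltNge => xr.
  by move: (lt_le_trans xr (le_trans (sqr_ge0 _) yr)) (sqr_ge0 (y - c.2)); lra.
Qed.

(** The substitution [x = c + r sin t] removes the square root, whose derivative
    blows up at both ends of the interval; what remains is the integral of
    [2 r^2 cos^2 t] over a half turn. *)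
Lemma integral_chord_length (R : realType) (c r : R) : 0 < r ->
  (\int[@lebesgue_measure R]_(x in [set` `[(c - r)%R, (c + r)%R]])
     (2 * Num.sqrt (r ^+ 2 - (x - c) ^+ 2))%R%:E = (pi * r ^+ 2)%R%:E)%E.
Proof.
move=> r0.
pose F t := c + r * sin t.
have dF t : is_derive t (1 : R) F (r * cos t).
  rewrite /F; apply: is_derive_eq.
  by rewrite add0r /GRing.scale/= mul1r.
have F'E : derive1 F = (fun t => r * cos t).
  by apply/funext => t; rewrite derive1E derive_val.
have cF : continuous F.
  by move=> t; apply/differentiable_continuous/derivable1_diffP; case: (dF t).
have cF' : continuous (fun t : R => r * cos t).
  by move=> t; apply: cvgMr; exact: continuous_cos.
pose p : R := pi / 2.
have p0 : 0 < p by rewrite divr_gt0// pi_gt0.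
have -> : c - r = F (- p) by rewrite /F sinN sin_pihalf; ring.
have -> : c + r = F p by rewrite /F sin_pihalf; ring.
have Fincr : {in `[- p, p] &, {homo F : u v / u < v}}.
  by move=> u v up vp uv; rewrite /F ltrD2l ltr_pM2l// ltr_sin.
have cG : continuous (fun x => 2 * Num.sqrt (r ^+ 2 - (x - c) ^+ 2)).
  move=> x; apply: cvgMr.
  apply: (@continuous_comp R R R (fun x => r ^+ 2 - (x - c) ^+ 2)
    Num.sqrt); last exact: sqrt_continuous.
  apply: cvgB; first exact: cvg_cst.
  apply: (@continuous_comp R R R (fun x => x - c) (fun x => x ^+ 2)).
    by apply: cvgB; [exact: cvg_id|exact: cvg_cst].
  exact: exprn_continuous.
rewrite integration_by_substitution_increasing//; first last.
- exact: continuous_subspaceT.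
- split.
  + by move=> t _; case: (dF t).
  + exact/cvg_at_right_filter/cF.
  + exact/cvg_at_left_filter/cF.
- rewrite F'E; apply/cvg_ex; eexists; exact/cvg_at_left_filter/cF'.
- rewrite F'E; apply/cvg_ex; eexists; exact/cvg_at_right_filter/cF'.
- by move=> t _; rewrite F'E; exact: cF'.
- by rewrite ltW// gtrN.
(* [H] is a primitive of [2 r^2 cos^2 t], by [1 + cos^2 t - sin^2 t =
   2 cos^2 t]. *)
pose H t : R := r ^+ 2 * (t + sin t * cos t).
have dH t : is_derive t (1 : R) H (2 * r ^+ 2 * cos t ^+ 2).
  rewrite /H; apply: is_derive_eq.
  by rewrite -[X in X + _](cos2Dsin2 t) /GRing.scale/=; ring.
transitivity (\int[@lebesgue_measure R]_(t in `[(- p)%R, p])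
    (2 * r ^+ 2 * cos t ^+ 2)%R%:E)%E.
  apply: eq_integral.
  move=> t; rewrite inE/= in_itv/= => /andP[tp pt]; congr EFin.
  rewrite F'E.
  transitivity (2 * Num.sqrt (r ^+ 2 - (F t - c) ^+ 2) * (r * cos t)) => //.
  have -> : r ^+ 2 - (F t - c) ^+ 2 = (r * cos t) ^+ 2.
    by rewrite exprMn cos2sin2 /F; ring.
  rewrite sqrtr_sqr ger0_norm; first by ring.
  by rewrite mulr_ge0 ?(ltW r0)// cos_ge0_pihalf// tp pt.
rewrite (continuous_FTC2 (F := H)).
- rewrite -EFinB; congr EFin; rewrite /H sinN cosN sin_pihalf cos_pihalf.
  by rewrite /p; field.
- by rewrite gtrN.
- apply: continuous_subspaceT => t; apply: cvgMr.
  apply: (@continuous_comp R R R cos (fun x => x ^+ 2)); first exact: continuous_cos.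
  exact: exprn_continuous.
- have cH : continuous H.
    by move=> t; apply/differentiable_continuous/derivable1_diffP; case: (dH t).
  split.
  + by move=> t _; case: (dH t).
  + exact/cvg_at_right_filter/cH.
  + exact/cvg_at_left_filter/cH.
- by move=> t _; rewrite derive1E derive_val.
Qed.

(** Slicing by vertical lines: the product measure integrates the lengths of
    the chords. *)
Lemma area_disk (R : realType) (c : R * R) (r : R) : 0 <= r ->
  area (disk c r) = (pi * r ^+ 2)%:E.
Proof.
move=> r0; rewrite /area /product_measure1.
transitivity (\int[@lebesgue_measure R]_(x in `[(c.1 - r)%R, (c.1 + r)%R])
     (2 * Num.sqrt (r ^+ 2 - (x - c.1) ^+ 2))%R%:E)%E.
  rewrite [RHS]integral_mkcond; apply: eq_integral => x _ /=.
  rewrite xsection_disk// patchE mem_setE; case: ifPn => _; last exact: measure0.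
  rewrite lebesgue_measure_itv/= lte_fin.
  have := sqrtr_ge0 (r ^+ 2 - (x - c.1) ^+ 2).
  set s := Num.sqrt _; rewrite le_eqVlt => /predU1P[<-|s0].
    by rewrite addr0 subr0 ltxx mulr0.
  by rewrite ltrD2l gtrN// -EFinB; congr EFin; ring.
(* A disk of radius 0 is a point: the interval of integration degenerates. *)
move: r0; rewrite le_eqVlt => /predU1P[<-|r0].
  by rewrite subr0 addr0 set_itv1 integral_set1 expr0n mulr0.
exact: integral_chord_length.
Qed.

(** * Bicentric pentagons of two concentric circles *)

Section CircularPentagon.
Context {R : realType}.
Variables (x y : 'Z_5 -> R) (rho : R).
Hypothesis norm_xy : forall k, x k ^+ 2 + y k ^+ 2 = rho.
Hypothesis mid_xy : forall k,
  (x k + x (k + 1)) ^+ 2 + (y k + y (k + 1)) ^+ 2 = 4.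
Hypothesis inj_xy : injective (fun k => (x k, y k)).

Lemma vertices_apart i j : i != j -> 0 < (x i - x j) ^+ 2 + (y i - y j) ^+ 2.
Proof.
move=> ij; rewrite lt_neqAle addr_ge0 ?sqr_ge0// andbT eq_sym.
rewrite paddr_eq0 ?sqr_ge0// !sqrf_eq0 !subr_eq0.
by apply: contra ij => /andP[/eqP xij /eqP yij]; apply/eqP/inj_xy; congr pair.
Qed.

Lemma circumradius_gt1 : 1 < rho.
Proof.
have := @vertices_apart 0 1 isT.
by move: (norm_xy 0) (norm_xy 1) (mid_xy 0); rewrite add0r; lra.
Qed.

(** If the central angle of a side is [t] and the circumradius is [sqrt rho],
    then [cos (t / 2) = 1 / sqrt rho], so that this number is [2 cos t]: the trace
    of the rotation that carries each vertex to the next one. *)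
Definition turn : R := 4 / rho - 2.

Lemma rho_turn : rho * (turn + 2) = 4.
Proof. by rewrite /turn; field; apply/eqP; move: circumradius_gt1; lra. Qed.

(** Every side has the same central angle, because its midpoint is at distance
    1 from the center. *)
Lemma consecutive_dot k : x k * x (k + 1) + y k * y (k + 1) = 2 - rho.
Proof. by move: (norm_xy k) (norm_xy (k + 1)) (mid_xy k); lra. Qed.

(** The two neighbours of a vertex [v] make the same angle with it and are
    distinct, hence they are mirror images in the line through the center and [v].
    Their sum is therefore a multiple of [v], whose factor is read off from the
    dot products.  The hypotheses are symmetric in [x] and [y], so one coordinate
    is enough. *)
Lemma chord_recurrence k : x (k - 1) + x (k + 1) = turn * x k.
Proof.
have rho0 : rho != 0 by apply/eqP; move: circumradius_gt1; lra.
have := @vertices_apart (k - 1) (k + 1).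
rewrite (inj_eq (addrI k)) => /(_ isT).
move: (norm_xy (k - 1)) (norm_xy (k + 1)) (norm_xy k).
move: (consecutive_dot (k - 1)) (consecutive_dot k); rewrite subrK.
set u1 := x (k - 1); set u2 := y (k - 1); set w1 := x (k + 1).
set w2 := y (k + 1); set v1 := x k; set v2 := y k.
move=> uv vw uu ww vv uw.
(* The difference of the two neighbours is orthogonal to [v] and to their sum;
   being nonzero, it forces these two vectors to be parallel. *)
have dv : (u1 - w1) * v1 + (u2 - w2) * v2 = 0 by lra.
have ds : (u1 - w1) * (u1 + w1) + (u2 - w2) * (u2 + w2) = 0 by lra.
(* For the difference [d] and the sum [s] of the neighbours, [d.d] times the
   cross product of [v] and [s] is a linear combination of [d.v] and [d.s]. *)
have /eqP : ((u1 - w1) ^+ 2 + (u2 - w2) ^+ 2) *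
            (v1 * (u2 + w2) - v2 * (u1 + w1)) = 0.
  transitivity (
    ((u1 - w1) * (u2 + w2) - (u2 - w2) * (u1 + w1)) *
      ((u1 - w1) * v1 + (u2 - w2) * v2) +
    ((u2 - w2) * v1 - (u1 - w1) * v2) *
      ((u1 - w1) * (u1 + w1) + (u2 - w2) * (u2 + w2))); first by ring.
  by rewrite dv ds !mulr0 addr0.
rewrite mulf_eq0 gt_eqF//= => /eqP cross0.
apply: (mulfI rho0).
transitivity (v1 * (v1 * (u1 + w1) + v2 * (u2 + w2)) -
              v2 * (v1 * (u2 + w2) - v2 * (u1 + w1))).
  by rewrite -vv; ring.
rewrite cross0 mulr0 subr0.
have -> : v1 * (u1 + w1) + v2 * (u2 + w2) = 4 - 2 * rho by lra.
by rewrite -rho_turn; ring.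
Qed.

(** Two applications of the recurrence: the midpoint of the side opposite to a
    vertex lies on the line through the center and that vertex. *)
Lemma opposite_side_sum k : x (k + 2) + x (k + 3) = (turn ^+ 2 - 2) * x k.
Proof.
have := chord_recurrence (k + 1); have := chord_recurrence (k - 1).
have -> : k - 1 - 1 = k + 3 by rewrite -addrA; congr (_ + _); exact/val_inj.
have -> : k + 1 + 1 = k + 2 by rewrite -addrA.
rewrite addrK subrK => Ek1 Ek2.
have Ek := chord_recurrence k.
transitivity (turn * (x (k - 1) + x (k + 1)) - 2 * x k).
  by rewrite mulrDr -Ek1 -Ek2; ring.
by rewrite Ek; ring.
Qed.

End CircularPentagon.

Section CircularPentagonMetric.
Context {R : realType}.
Variables (x y : 'Z_5 -> R) (rho : R).
Hypothesis norm_xy : forall k, x k ^+ 2 + y k ^+ 2 = rho.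
Hypothesis mid_xy : forall k,
  (x k + x (k + 1)) ^+ 2 + (y k + y (k + 1)) ^+ 2 = 4.
Hypothesis inj_xy : injective (fun k => (x k, y k)).

Let norm_yx k : y k ^+ 2 + x k ^+ 2 = rho. Proof. by rewrite addrC. Qed.
Let mid_yx k : (y k + y (k + 1)) ^+ 2 + (x k + x (k + 1)) ^+ 2 = 4.
Proof. by rewrite addrC. Qed.
Let inj_yx : injective (fun k => (y k, x k)).
Proof. by move=> i j [yij xij]; apply: inj_xy; congr pair. Qed.

Local Notation c := (turn rho).

(** The midpoint of the opposite side has norm 1, which gives a quartic equation
    for [c].  Its roots [2] and [-1] belong to rotations by 0 and by a third of a
    turn, which would make two vertices coincide; the other two roots,
    [2 cos (2 pi / 5)] and [2 cos (4 pi / 5)], belong to the regular convex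
    pentagon and to the regular pentagram. *)
Lemma turn_golden : c ^+ 2 + c - 1 = 0.
Proof.
have rhoc := rho_turn norm_xy mid_xy inj_xy.
have rho1 := circumradius_gt1 norm_xy mid_xy inj_xy.
have recx := chord_recurrence norm_xy mid_xy inj_xy.
have recy := chord_recurrence norm_yx mid_yx inj_yx.
have rho0 : rho != 0 by apply/eqP; lra.
have c2 : c - 2 != 0 by apply/eqP; nra.
have cN1 : c + 1 != 0.
  apply/eqP => c1; have {}c1 : c = - 1 by lra.
  have : (x 2, y 2) = (x 4, y 4).
    have E4 : (0 - 1 : 'Z_5) = 4 by exact/val_inj.
    move: (recx 0) (recx 1) (recy 0) (recy 1).
    rewrite E4 add0r subrr c1 -[1 + 1]/(2 : 'Z_5) => x0 x1 y0 y1.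
    by congr pair; lra.
  by move/inj_xy.
have : rho * ((c ^+ 2 - 2) ^+ 2 - (c + 2)) = 0.
  have E3 : (2 + 1 : 'Z_5) = 3 by exact/val_inj.
  have sx := opposite_side_sum norm_xy mid_xy inj_xy 0.
  have sy := opposite_side_sum norm_yx mid_yx inj_yx 0.
  rewrite !add0r in sx sy.
  rewrite mulrBr rhoc -(mid_xy 2) E3 sx sy -(norm_xy 0).
  by ring.
have -> : (c ^+ 2 - 2) ^+ 2 - (c + 2) = (c - 2) * (c + 1) * (c ^+ 2 + c - 1).
  by ring.
by move=> /eqP; rewrite !mulf_eq0 (negbTE rho0) (negbTE c2) (negbTE cN1) => /eqP.
Qed.

(** The moment of inertia of a regular pentagon is the same about all axes
    through its center.  Since consecutive values of one coordinate satisfy a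
    linear recurrence, they lie on a conic, [conic] below; summing its equation
    over the vertices and using the recurrence to eliminate the mixed term
    leaves one equation for the sum of the squares. *)
Lemma sum_sqr_coordinate : \sum_k x k ^+ 2 = 5 / 2 * rho.
Proof.
have rec := chord_recurrence norm_xy mid_xy inj_xy.
have rhoc := rho_turn norm_xy mid_xy inj_xy.
have gold := turn_golden.
have conic k : x (k + 1) ^+ 2 - c * (x k * x (k + 1)) + x k ^+ 2
    = rho * (1 - c ^+ 2 / 4).
  have dot := consecutive_dot norm_xy mid_xy k.
  (* The two vectors have equal norms, and their dot product is known: this
     is the relation [(u.v - u1 v1)^2 = (u2 v2)^2] written with the first
     coordinates only. *)
  have lag : (2 - rho - x k * x (k + 1)) ^+ 2
      = (rho - x k ^+ 2) * (rho - x (k + 1) ^+ 2).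
    by rewrite -{1}dot -{1}(norm_xy k) -(norm_xy (k + 1)); ring.
  have rho0 : rho != 0.
    by apply/eqP; have := circumradius_gt1 norm_xy mid_xy inj_xy; lra.
  apply: (mulfI rho0).
  have E : 2 - rho = rho * c / 2 by move: rhoc; lra.
  by move: lag; rewrite E; nra.
have shift : \sum_k x (k + 1) ^+ 2 = \sum_k x k ^+ 2.
  by rewrite [RHS](reindex_inj (addIr (1 : 'Z_5))).
have cross : 2 * \sum_k x k * x (k + 1) = c * \sum_k x k ^+ 2.
  rewrite mulr_natl mulr2n mulr_sumr.
  rewrite [X in X + _](reindex_inj (addIr (-1 : 'Z_5))) -big_split/=.
  by apply: eq_bigr => k _; rewrite subrK expr2 mulrA -rec; ring.
have : \sum_k (x (k + 1) ^+ 2 - c * (x k * x (k + 1)) + x k ^+ 2)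
    = (rho * (1 - c ^+ 2 / 4)) *+ 5.
  by rewrite (eq_bigr _ (fun k _ => conic k)) sumr_const card_ord.
rewrite !big_split/= sumrN -mulr_sumr shift.
move: cross; set S := \sum_k x k ^+ 2; set T := \sum_k _ => cross total.
have c4 : 4 - c ^+ 2 != 0.
  have rho1 := circumradius_gt1 norm_xy mid_xy inj_xy.
  by apply/eqP; move: rho1 rhoc gold; nra.
apply: (mulfI c4).
have -> : (4 - c ^+ 2) * S = 2 * (S - c * T + S) by nra.
by rewrite total; field.
Qed.

(** The vector from a vertex to the midpoint of the opposite side is a multiple
    of the vertex.  The sum is [(c^2 - 4)^2 / 4] times [5 rho / 2], and
    [rho = 4 / (c + 2)] turns it into [5 (c - 2)^2 (c + 2) / 2]; modulo
    [c^2 + c - 1] the cubic [(c - 2)^2 (c + 2)] is the constant 5.  This is why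
    the convex pentagon and the pentagram give the same value. *)
Lemma sum_sqr_median :
  \sum_k ((x (k + 2) + x (k + 3)) / 2 - x k) ^+ 2 = 25 / 2.
Proof.
have opp := opposite_side_sum norm_xy mid_xy inj_xy.
have rhoc := rho_turn norm_xy mid_xy inj_xy.
have gold := turn_golden.
transitivity (\sum_k ((c ^+ 2 - 4) / 2) ^+ 2 * x k ^+ 2).
  by apply: eq_bigr => k _; rewrite opp; field.
rewrite -mulr_sumr sum_sqr_coordinate.
transitivity (5 / 8 * (rho * (c + 2)) * ((c - 2) ^+ 2 * (c + 2))); first by field.
have -> : (c - 2) ^+ 2 * (c + 2) = 5 by nra.
by rewrite rhoc; field.
Qed.

End CircularPentagonMetric.

(** * From the ellipse to the circle *)

Section EllipseFrame.
Context {R : realType}.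
Local Notation plane := (R * R)%type.
Variables (O u : plane) (a b : R).
Hypotheses (a_gt0 : 0 < a) (b_gt0 : 0 < b).
Hypothesis u_unit : u.1 ^+ 2 + u.2 ^+ 2 = 1.

(** Coordinates in the affine frame in which the ellipse with center [O],
    semi-axes [a] and [b], and axis direction [u] is the unit circle. *)
Definition coordx (p : plane) : R :=
  ((p.1 - O.1) * u.1 + (p.2 - O.2) * u.2) / a.
Definition coordy (p : plane) : R :=
  ((p.2 - O.2) * u.1 - (p.1 - O.1) * u.2) / b.

Definition frame_ellipse : set plane :=
  [set p | coordx p ^+ 2 + coordy p ^+ 2 = 1].

Let a_neq0 : a != 0. Proof. by rewrite gt_eqF. Qed.
Let b_neq0 : b != 0. Proof. by rewrite gt_eqF. Qed.

Lemma sqr_edist_coord p q :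
  Defs.edist p q ^+ 2 = a ^+ 2 * (coordx p - coordx q) ^+ 2 +
                   b ^+ 2 * (coordy p - coordy q) ^+ 2.
Proof.
rewrite /Defs.edist sqr_sqrtr ?addr_ge0 ?sqr_ge0//.
transitivity (((p.1 - q.1) ^+ 2 + (p.2 - q.2) ^+ 2) *
              (u.1 ^+ 2 + u.2 ^+ 2)); first by rewrite u_unit mulr1.
by rewrite /coordx /coordy; field; rewrite a_neq0 b_neq0.
Qed.

Lemma coord_inj p q : coordx p = coordx q -> coordy p = coordy q -> p = q.
Proof.
move=> xpq ypq; have := sqr_edist_coord p q.
rewrite xpq ypq !subrr expr0n !mulr0 addr0.
rewrite /Defs.edist sqr_sqrtr ?addr_ge0 ?sqr_ge0// => /eqP.
rewrite paddr_eq0 ?sqr_ge0// !sqrf_eq0 !subr_eq0 => /andP[/eqP + /eqP].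
by case: p q {xpq ypq} => [p1 p2] [q1 q2] /= -> ->.
Qed.

Lemma coord_homothety k p : (homothety O k @` frame_ellipse) p ->
  coordx p ^+ 2 + coordy p ^+ 2 = k ^+ 2.
Proof.
move=> [q qE <-].
transitivity (k ^+ 2 * (coordx q ^+ 2 + coordy q ^+ 2)).
  by rewrite /coordx /coordy /homothety /=; field; rewrite a_neq0 b_neq0.
by rewrite qE mulr1.
Qed.

(** When [p] and [q] are at equal distance from the center in the frame, the
    symmetry of the chord that exchanges [p] and [q] preserves the points common
    to the line and the ellipse.  A unique common point is thus fixed by it: it
    is the midpoint of [p] and [q]. *)
Lemma tangent_midpoint p q : p <> q ->
  coordx p ^+ 2 + coordy p ^+ 2 = coordx q ^+ 2 + coordy q ^+ 2 ->
  tangent (line p q) frame_ellipse ->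
  (coordx p + coordx q) ^+ 2 + (coordy p + coordy q) ^+ 2 = 4.
Proof.
move=> pq normpq [m lm].
pose pt t : plane := (p.1 + t * (q.1 - p.1), p.2 + t * (q.2 - p.2)).
have xpt t : coordx (pt t) = coordx p + t * (coordx q - coordx p).
  by rewrite /coordx /pt /=; field.
have ypt t : coordy (pt t) = coordy p + t * (coordy q - coordy p).
  by rewrite /coordy /pt /=; field.
have [[t _ tm] Em] : (line p q `&` frame_ellipse) m by rewrite lm.
have {}tm : pt t = m := tm.
have Et : frame_ellipse (pt t) by rewrite tm.
have t'm : pt (1 - t) = m.
  suff : (line p q `&` frame_ellipse) (pt (1 - t)) by rewrite lm.
  split; first by exists (1 - t).
  move: Et; rewrite /frame_ellipse /= !xpt !ypt => Et.
  transitivity (1 + (1 - 2 * t) *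
    (coordx q ^+ 2 + coordy q ^+ 2 - (coordx p ^+ 2 + coordy p ^+ 2))).
    by rewrite -[X in _ = X + _]Et; ring.
  by rewrite normpq subrr mulr0 addr0.
have t2 : t = 2^-1.
  apply: contra_notP pq => /eqP t2.
  have eq_ends z w : z + t * (w - z) = z + (1 - t) * (w - z) -> z = w.
    move=> /eqP; rewrite -subr_eq0.
    have -> : z + t * (w - z) - (z + (1 - t) * (w - z)) =
              2 * (t - 2^-1) * (w - z) by field.
    by rewrite !mulf_eq0 pnatr_eq0/= !subr_eq0 (negbTE t2)/= => /eqP.
  by apply: coord_inj; apply: eq_ends; rewrite -?xpt -?ypt tm t'm.
by move: Et; rewrite /frame_ellipse/= xpt ypt t2; lra.
Qed.

(** The squared radii are computed along the axes of the ellipse, and each axis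
    contributes [25 / 2] times the square of its semi-axis, by [sum_sqr_median]
    applied to each of the two coordinates. *)
Lemma sum_power_circle_area k (P : 'Z_5 -> plane) : pentagon P ->
  inscribed P (homothety O k @` frame_ellipse) ->
  circumscribed P frame_ellipse ->
  (\sum_(i : 'Z_5) power_circle_area P i =
   (25 / 2 * pi * (a ^+ 2 + b ^+ 2))%:E)%E.
Proof.
move=> injP inP circP.
pose x i := coordx (P i); pose y i := coordy (P i).
have norm_xy i : x i ^+ 2 + y i ^+ 2 = k ^+ 2 by exact: coord_homothety.
have norm_yx i : y i ^+ 2 + x i ^+ 2 = k ^+ 2 by rewrite addrC.
have mid_xy i : (x i + x (i + 1)) ^+ 2 + (y i + y (i + 1)) ^+ 2 = 4.
  apply: tangent_midpoint; last exact: circP.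
  - by move=> /injP /eqP; rewrite -subr_eq0 opprD addNKr.
  - by rewrite norm_xy norm_xy.
have mid_yx i : (y i + y (i + 1)) ^+ 2 + (x i + x (i + 1)) ^+ 2 = 4.
  by rewrite addrC.
have inj_xy : injective (fun i => (x i, y i)).
  by move=> i j [xij yij]; apply/injP/coord_inj.
have inj_yx : injective (fun i => (y i, x i)).
  by move=> i j [yij xij]; apply/injP/coord_inj.
transitivity (\sum_(i : 'Z_5)
    (pi * (a ^+ 2 * ((x (i + 2) + x (i + 3)) / 2 - x i) ^+ 2 +
           b ^+ 2 * ((y (i + 2) + y (i + 3)) / 2 - y i) ^+ 2))%:E)%E.
  apply: eq_bigr => i _.
  rewrite /power_circle_area area_disk ?sqrtr_ge0// sqr_edist_coord.
  by congr (_ * (_ * (_ - _) ^+ 2 + _ * (_ - _) ^+ 2))%:E;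
    rewrite /x /y /coordx /coordy /power_center /midpoint /=; field.
rewrite sumEFin -mulr_sumr big_split/= -!mulr_sumr.
rewrite (sum_sqr_median norm_xy)// (sum_sqr_median norm_yx)//.
by congr EFin; ring.
Qed.

End EllipseFrame.

Theorem corollary5 (R : realType) (O : R * R) (D1 D2 D : set (R * R))
    (P1 P2 : 'Z_5 -> R * R)
    (ell_D1 : is_ellipse O D1) (ell_D2 : is_ellipse O D2)
    (ell_D : is_ellipse O D)
    (homoth : homothetic O [set D1; D2; D])
    (pent_P1 : pentagon P1) (in_P1 : inscribed P1 D1)
    (dens_P1 : has_density O P1 1) (circ_P1 : circumscribed P1 D)
    (pent_P2 : pentagon P2) (in_P2 : inscribed P2 D2)
    (dens_P2 : has_density O P2 2) (circ_P2 : circumscribed P2 D) :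
  (\sum_(k : 'Z_5) power_circle_area P1 k =
   \sum_(k : 'Z_5) power_circle_area P2 k)%E.
Proof.
have [k1 _ D1E] : exists2 k, k != 0 & D1 = homothety O k @` D.
  by apply: homoth; [right|left; left].
have [k2 _ D2E] : exists2 k, k != 0 & D2 = homothety O k @` D.
  by apply: homoth; [right|left; right].
case: ell_D => a [b [u [a0 b0 u1 DE]]].
have {}DE : D = frame_ellipse O u a b by [].
rewrite D1E DE in in_P1; rewrite D2E DE in in_P2; rewrite DE in circ_P1 circ_P2.
rewrite (sum_power_circle_area a0 b0 u1 pent_P1 in_P1)//.
by rewrite (sum_power_circle_area a0 b0 u1 pent_P2 in_P2).
Qed.
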